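(* The word problem in $\mathbb{G}=\langle a,b,c,d\rangle$ can be solved in $O(n\log n)$ time: there is an algorithm which, given a word $w$ of length $n$ in the generators $a,b,c,d$, decides in $O(n\log n)$ time whether the product $w$ equals the identity in $\mathbb{G}$.
   Context: Let $\mathbf{T}$ be the infinite rooted binary tree whose vertices are the finite words over $\{0,1\}$; the root is the empty word, and the oriented edges go from $v$ to $v0$ and from $v$ to $v1$. $\mathrm{Aut}(\mathbf{T})$ is the group of bijections of the vertex set mapping edges into edges (they fix the root and preserve levels), with product $(\tau_1\cdot\tau_2)(v)=\tau_2(\tau_1(v))$ and identity $\mathtt{I}$. Let $a\in\mathrm{Aut}(\mathbf{T})$ fix the root and satisfy $a(0w)=1w$, $a(1w)=0w$ for all words $w$. For $\tau_0,\tau_1\in\mathrm{Aut}(\mathbf{T})$ let $\varphi(\tau_0,\tau_1)\in\mathrm{Aut}(\mathbf{T})$ be the automorphism fixing the root with $0w\mapsto 0\,\tau_0(w)$, $1w\mapsto 1\,\tau_1(w)$. Let $b,c,d\in\mathrm{Aut}(\mathbf{T})$ be the (unique) automorphisms with $b=\varphi(a,c)$, $c=\varphi(a,d)$, $d=\varphi(\mathtt{I},b)$, and let $\mathbb{G}=\langle a,b,c,d\rangle$. The generators $a,b,c,d$ are involutions, so words in $a,b,c,d$ (without inverses) suffice. The word problem for $G=\langle S\rangle$: given a word $w=s_{i_1}\cdots s_{i_n}$ in the generators, decide whether the product equals the identity in $G$. Time is counted as the number of elementary steps (reading, replacing or deleting a letter). *)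

(* Defs.v *)
From HB Require Import structures.
From mathcomp Require Import all_boot.
From mathcomp Require Import boolp.

Set Implicit Arguments.
Unset Strict Implicit.
Unset Printing Implicit Defensive.

Local Open Scope group_scope.

(** * The rooted binary tree and its automorphisms *)

(* The letters 0 and 1 are [false] and [true]; the root is [[::]]. *)
Definition vertex := seq bool.

Definition edge (u v : vertex) : bool :=
  (v == rcons u false) || (v == rcons u true).

Record autT := AutT {
  aut_fun :> vertex -> vertex;
  aut_bij : bijective aut_fun;
  aut_edge : {homo aut_fun : u v / edge u v}
}.

HB.instance Definition _ := gen_eqMixin autT.
HB.instance Definition _ := gen_choiceMixin autT.

Lemma autT_ext (s t : autT) : s =1 t -> s = t.
Proof.
case: s t => [f fb fe] [g gb ge] /= /funext fg; move: fb fe gb ge.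
by rewrite {}fg => fb fe gb ge; congr AutT; apply: Prop_irrelevance.
Qed.

Lemma edge_rcons u x : edge u (rcons u x).
Proof. by case: x; rewrite /edge eqxx ?orbT. Qed.

Lemma edgeP u v : reflect (exists x, v = rcons u x) (edge u v).
Proof.
apply: (iffP orP) => [[/eqP -> | /eqP ->] | [[] ->]].
- by exists false.
- by exists true.
- by right.
- by left.
Qed.

Lemma edge_inj u1 u2 v : edge u1 v -> edge u2 v -> u1 = u2.
Proof. by move=> /edgeP[x ->] /edgeP[y /rcons_inj[]]. Qed.

Lemma edge_nil u : edge u [::] = false.
Proof. by apply/edgeP => -[x /(congr1 size)]; rewrite size_rcons. Qed.

Lemma aut_root (s : autT) : s [::] = [::].
Proof.
have [g _ gK] := aut_bij s.
have := gK [::]; case/lastP: (g [::]) => [//|p x] sx.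
by have := aut_edge s (edge_rcons p x); rewrite sx edge_nil.
Qed.

Fact aut1_edge : {homo (@id vertex) : u v / edge u v}.
Proof. by []. Qed.

Definition aut1 : autT := AutT (inv_bij (fun=> erefl)) aut1_edge.

Fact aut_mul_edge (s t : autT) : {homo t \o s : u v / edge u v}.
Proof. by move=> u v uv; apply/aut_edge/aut_edge. Qed.

Definition aut_mul (s t : autT) : autT :=
  AutT (bij_comp (aut_bij t) (aut_bij s)) (@aut_mul_edge s t).

Fact aut_surj (s : autT) v : exists u, s u == v.
Proof. by have [g _ gK] := aut_bij s; exists (g v); rewrite gK. Qed.

Definition aut_inv_fun (s : autT) (v : vertex) : vertex :=
  xchoose (aut_surj s v).

Fact aut_inv_funK (s : autT) : cancel (aut_inv_fun s) s.
Proof. by move=> v; apply/eqP/(xchooseP (aut_surj s v)). Qed.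

Fact aut_funK (s : autT) : cancel s (aut_inv_fun s).
Proof. by move=> u; apply: (bij_inj (aut_bij s)); rewrite aut_inv_funK. Qed.

Fact aut_inv_edge (s : autT) : {homo aut_inv_fun s : u v / edge u v}.
Proof.
move=> u v uv; rewrite -[v](aut_inv_funK s) in uv.
case/lastP: (aut_inv_fun s v) uv => [|p x] uv.
  by rewrite aut_root edge_nil in uv.
rewrite (edge_inj uv (aut_edge s (edge_rcons p x))) aut_funK.
exact: edge_rcons.
Qed.

Definition aut_inv (s : autT) : autT :=
  AutT (Bijective (@aut_inv_funK s) (@aut_funK s)) (@aut_inv_edge s).

Fact aut_mulA : associative aut_mul.
Proof. by move=> s t r; apply: autT_ext. Qed.
Fact aut_mul1 : left_id aut1 aut_mul.
Proof. by move=> s; apply: autT_ext. Qed.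
Fact aut_mulr1 : right_id aut1 aut_mul.
Proof. by move=> s; apply: autT_ext. Qed.
Fact aut_mulV : left_inverse aut1 aut_inv aut_mul.
Proof. by move=> s; apply: autT_ext => v /=; rewrite aut_inv_funK. Qed.
Fact aut_mulrV : right_inverse aut1 aut_inv aut_mul.
Proof. by move=> s; apply: autT_ext => v /=; rewrite aut_funK. Qed.

HB.instance Definition _ :=
  isGroup.Build autT aut_mulA aut_mul1 aut_mulr1 aut_mulV aut_mulrV.

Lemma aut1E v : (1 : autT) v = v. Proof. by []. Qed.
Lemma aut_mulE (s t : autT) v : (s * t) v = t (s v). Proof. by []. Qed.

Definition phi_fun (s t : vertex -> vertex) (v : vertex) : vertex :=
  match v with
  | [::] => [::]
  | false :: w => false :: s w
  | true :: w => true :: t w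
  end.

Fact phi_bij (s t : autT) : bijective (phi_fun s t).
Proof.
exists (phi_fun (aut_inv s) (aut_inv t)).
  by case=> [|[] w] //=; rewrite aut_funK.
by case=> [|[] w] //=; rewrite aut_inv_funK.
Qed.

Lemma edge_cons x u v : edge (x :: u) (x :: v) = edge u v.
Proof. by rewrite /edge /= !eqseq_cons eqxx. Qed.

Fact phi_edge (s t : autT) : {homo phi_fun s t : u v / edge u v}.
Proof.
move=> u v /edgeP[x ->]; case: u => [|[] u] /=.
- by case: x; rewrite /= aut_root.
- by rewrite edge_cons aut_edge ?edge_rcons.
- by rewrite edge_cons aut_edge ?edge_rcons.
Qed.

Definition phi (s t : autT) : autT := AutT (phi_bij s t) (@phi_edge s t).

(** * The automorphisms a, b, c, d *)

Definition a_fun (v : vertex) : vertex :=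
  if v is x :: w then ~~ x :: w else [::].

Fact a_funK : involutive a_fun.
Proof. by case=> [|x w] //=; rewrite negbK. Qed.

Fact a_edge : {homo a_fun : u v / edge u v}.
Proof.
move=> u v /edgeP[x ->]; case: u => [|y u] /=; first by case: x.
by rewrite edge_cons edge_rcons.
Qed.

Definition gen_a : autT := AutT (inv_bij a_funK) a_edge.

(* The recursion b = phi a c, c = phi a d, d = phi 1 b, unfolded on words;
   see [gen_bE], [gen_cE], [gen_dE] and [gen_bcd_unique] below. *)
Fixpoint b_fun (v : vertex) : vertex :=
  match v with
  | [::] => [::]
  | false :: w => false :: a_fun w
  | true :: w => true :: c_fun w
  end
with c_fun (v : vertex) : vertex :=
  match v with
  | [::] => [::]
  | false :: w => false :: a_fun w
  | true :: w => true :: d_fun w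
  end
with d_fun (v : vertex) : vertex :=
  match v with
  | [::] => [::]
  | false :: w => false :: w
  | true :: w => true :: b_fun w
  end.

Fact bcd_funK :
  [/\ involutive b_fun, involutive c_fun & involutive d_fun].
Proof.
suff H v : [/\ b_fun (b_fun v) = v, c_fun (c_fun v) = v & d_fun (d_fun v) = v].
  by split=> v; have [] := H v.
elim: v => [|x v [IHb IHc IHd]] //.
by case: x => /=; rewrite ?a_funK ?IHb ?IHc ?IHd.
Qed.

Fact bcd_edge :
  [/\ {homo b_fun : u v / edge u v}, {homo c_fun : u v / edge u v}
    & {homo d_fun : u v / edge u v}].
Proof.
suff H x u : [/\ edge (b_fun u) (b_fun (rcons u x)),
    edge (c_fun u) (c_fun (rcons u x)) & edge (d_fun u) (d_fun (rcons u x))].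
  by split=> u v /edgeP[x ->]; have [] := H x u.
elim: u => [|y u [IHb IHc IHd]]; first by case: x.
by case: y; rewrite /= !edge_cons ?a_edge ?edge_rcons.
Qed.

Fact b_funK : involutive b_fun. Proof. by case: bcd_funK. Qed.
Fact c_funK : involutive c_fun. Proof. by case: bcd_funK. Qed.
Fact d_funK : involutive d_fun. Proof. by case: bcd_funK. Qed.
Fact b_edge : {homo b_fun : u v / edge u v}. Proof. by case: bcd_edge. Qed.
Fact c_edge : {homo c_fun : u v / edge u v}. Proof. by case: bcd_edge. Qed.
Fact d_edge : {homo d_fun : u v / edge u v}. Proof. by case: bcd_edge. Qed.

Definition gen_b : autT := AutT (inv_bij b_funK) b_edge.
Definition gen_c : autT := AutT (inv_bij c_funK) c_edge.
Definition gen_d : autT := AutT (inv_bij d_funK) d_edge.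

Lemma gen_bE : gen_b = phi gen_a gen_c.
Proof. by apply: autT_ext => -[|[] w]. Qed.
Lemma gen_cE : gen_c = phi gen_a gen_d.
Proof. by apply: autT_ext => -[|[] w]. Qed.
Lemma gen_dE : gen_d = phi 1 gen_b.
Proof. by apply: autT_ext => -[|[] w]. Qed.

Lemma gen_bcd_unique (b c d : autT) :
  b = phi gen_a c -> c = phi gen_a d -> d = phi 1 b ->
  [/\ b = gen_b, c = gen_c & d = gen_d].
Proof.
move=> bE cE dE.
suff H v : [/\ b v = gen_b v, c v = gen_c v & d v = gen_d v].
  by split; apply: autT_ext => v; have [] := H v.
elim: v => [|x v [IHb IHc IHd]]; first by rewrite !aut_root.
split; [rewrite bE gen_bE | rewrite cE gen_cE | rewrite dE gen_dE];
  by case: x => /=; rewrite ?IHb ?IHc ?IHd.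
Qed.

(** * Subgroup generated by a family, and the group <a, b, c, d> *)

Definition generated (gT : groupType) (I : Type) (s : I -> gT) : {pred gT} :=
  fun x => `[< forall H : {pred gT},
    group_closed H -> (forall i, s i \in H) -> x \in H >].

Fact generated_closed (gT : groupType) (I : Type) (s : I -> gT) :
  group_closed (generated s).
Proof.
split=> [|x y /asboolP sx /asboolP sy]; apply/asboolP => H Hcl sH.
  by case: Hcl.
by case: (Hcl) => _; apply; [apply: sx | apply: sy].
Qed.

Fact mem_generated (gT : groupType) (I : Type) (s : I -> gT) i :
  s i \in generated s.
Proof. by apply/asboolP => H _; apply. Qed.

Inductive letter := La | Lb | Lc | Ld.

Definition letter_code (x : letter) : bool * bool :=
  match x with
  | La => (false, false) | Lb => (false, true)
  | Lc => (true, false) | Ld => (true, true)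
  end.

Definition letter_decode (p : bool * bool) : letter :=
  match p with
  | (false, false) => La | (false, true) => Lb
  | (true, false) => Lc | (true, true) => Ld
  end.

Fact letter_codeK : cancel letter_code letter_decode. Proof. by case. Qed.

HB.instance Definition _ := Countable.copy letter (can_type letter_codeK).
HB.instance Definition _ : isFinite letter := CanIsFinite letter_codeK.

Definition gen (x : letter) : autT :=
  match x with La => gen_a | Lb => gen_b | Lc => gen_c | Ld => gen_d end.

Record grigorchuk := Grigorchuk {
  grig_val :> autT;
  grig_mem : grig_val \in generated gen
}.

HB.instance Definition _ := [isSub for grig_val].
HB.instance Definition _ := [Choice of grigorchuk by <:].
HB.instance Definition _ :=
  SubChoice_isSubGroup.Build autT (generated gen) grigorchuk
    (generated_closed gen).

Definition grig_gen (x : letter) : grigorchuk :=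
  Grigorchuk (mem_generated gen x).

(* The generators are involutions, so words over [letter] need no inverses. *)
Lemma grig_gen_invol x : grig_gen x * grig_gen x = 1.
Proof.
apply/val_inj/autT_ext => v; case: x => /=.
- exact: a_funK.
- exact: b_funK.
- exact: c_funK.
- exact: d_funK.
Qed.

Definition word_problem (gT : groupType) (I : Type) (s : I -> gT) (w : seq I)
  : Prop := \prod_(i <- w) s i = 1.

(** * Deterministic multitape Turing machines *)

Inductive move := MoveL | MoveN | MoveR.

(* A two-way infinite tape: the scanned cell, the cells to its left and the
   cells to its right (both listed starting next to the head).  All cells
   beyond the two lists hold the blank, which is [None]. *)
Record tape (X : Type) := Tape {
  tape_left : seq (option X);
  tape_head : option X;
  tape_right : seq (option X)
}.

Definition tape_of (X : Type) (w : seq X) : tape X :=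
  if w is x :: v then Tape [::] (Some x) (map Some v)
  else Tape [::] None [::].

Definition tape_write (X : Type) (x : option X) (t : tape X) : tape X :=
  Tape (tape_left t) x (tape_right t).

Definition tape_move (X : Type) (m : move) (t : tape X) : tape X :=
  let: Tape l x r := t in
  match m with
  | MoveL => Tape (behead l) (head None l) (x :: r)
  | MoveN => t
  | MoveR => Tape (x :: l) (head None r) (behead r)
  end.

(* A machine with input alphabet [A].  The tape symbols are the input letters,
   the auxiliary letters [tm_aux] and the blank.  There are [tm_ntapes.+1]
   tapes, so at least one.  The machine halts with answer [b] on reaching a
   state [q] such that [tm_verdict q = Some b]. *)
Record turing_machine (A : finType) := TuringMachine {
  tm_ntapes : nat;
  tm_aux : finType;
  tm_state : finType;
  tm_start : tm_state;
  tm_verdict : tm_state -> option bool;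
  tm_trans : tm_state -> {ffun 'I_tm_ntapes.+1 -> option (A + tm_aux)} ->
    tm_state * {ffun 'I_tm_ntapes.+1 -> option (A + tm_aux) * move}
}.

Section Run.
Variables (A : finType) (M : turing_machine A).

Definition tm_symbol : Type := (A + tm_aux M)%type.

Definition tm_config : Type :=
  (tm_state M * {ffun 'I_(tm_ntapes M).+1 -> tape tm_symbol})%type.

(* The input is written on tape 0, with the head on its first letter. *)
Definition tm_init (w : seq A) : tm_config :=
  (tm_start M,
   [ffun i => if i == ord0 then tape_of (map inl w) else tape_of [::]]).

Definition tm_step (c : tm_config) : tm_config :=
  let: (q, ts) := c in
  if tm_verdict q is Some _ then c else
  let: (q', acts) := tm_trans q [ffun i => tape_head (ts i)] in
  (q', [ffun i => tape_move (acts i).2 (tape_write (acts i).1 (ts i))]).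

Definition tm_answers_at (w : seq A) (t : nat) (b : bool) : Prop :=
  tm_verdict (iter t tm_step (tm_init w)).1 = Some b.

End Run.

(* On every input [w], [M] halts after at most [T (size w)] steps and its
   answer says whether [w] belongs to the language [L]. *)
Definition decides_in_time (A : finType) (M : turing_machine A)
    (L : seq A -> Prop) (T : nat -> nat) : Prop :=
  forall w : seq A, exists (t : nat) (b : bool),
    [/\ (t <= T (size w))%N, tm_answers_at M w t b & b <-> L w].

Definition big_O (f g : nat -> nat) : Prop :=
  exists C n0 : nat, forall n : nat, n0 <= n -> (f n <= C * g n)%N.

(* Main.v *)
Require Import Defs.
From HB Require Import structures.
From mathcomp Require Import all_boot.
From mathcomp Require Import zify.

(** An element of the group acts on the two subtrees below the root through its
    two sections, after possibly exchanging them.  For a word [w], the letters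
    of the section at [s] are read off letter by letter ([ev_section]): each
    [a] changes sides, and each of [b], [c], [d] contributes the letter by which
    it acts on the current side.  So [w] is trivial exactly when its number of
    [a]'s is even and both sections are trivial ([ev_section1]).

    Since [{1, b, c, d}] is a Klein four-group and [a] is an involution, one
    pass over [w] with a stack replaces it by a word in which [a] alternates
    with the other three letters.  Only the latter contribute to the sections,
    at most one letter each, so a word of length [n] has two sections of length
    at most [(n + 1) / 2] ([size_sec_reduce]).

    This makes divide and conquer work.  Measure a word by its length minus
    one: the measures of the two sections are each at most half of the measure
    of [w], hence add up to no more than it, and the depth of the recursion is
    logarithmic.  A word of length at least two has positive measure, so its
    linear processing cost, as well as the constant cost of the leaves, can be
    charged to the measure, and each level of the recursion costs [O(n)]
    ([solves_log]).  Words of length at most one do not shrink, since the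
    section of [b] is [c], that of [c] is [d], and that of [d] is [b]; but [b]
    and [c] also have the section [a], which is odd, so exploring the section
    at 0 first rejects all three in boundedly many steps ([solves_base]).

    The recursion is a depth-first search run by a machine with three stacks:
    the words still to be tested, the reduced word being built or split, and a
    buffer for one of its two sections.  Stacks deliver words backwards, that is
    inverted, which is harmless for triviality.  A Turing machine with one tape
    per stack simulates each such step by two of its own ([tm_of_verdict]). *)

Set Implicit Arguments.
Unset Strict Implicit.
Unset Printing Implicit Defensive.

Local Open Scope group_scope.

(** * Machines with several stacks *)

Inductive stack_op (X : Type) := Keep | Pop | Put of X | Push of X.
Arguments Keep {X}.
Arguments Pop {X}.

Definition op_apply (X : Type) (o : stack_op X) (l : seq X) : seq X :=
  match o with
  | Keep => l
  | Pop => behead l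
  | Put x => x :: behead l
  | Push x => x :: l
  end.

Record stack_machine (A : finType) := StackMachine {
  sm_nstacks : nat;
  sm_aux : finType;
  sm_state : finType;
  sm_start : sm_state;
  sm_verdict : sm_state -> option bool;
  sm_trans : sm_state -> {ffun 'I_sm_nstacks.+1 -> option (A + sm_aux)} ->
    sm_state * {ffun 'I_sm_nstacks.+1 -> stack_op (A + sm_aux)}
}.

Section Simulation.
Variables (A : finType) (M : stack_machine A).
Local Notation X := (A + sm_aux M)%type.
Local Notation I := 'I_(sm_nstacks M).+1.

Definition sm_init (w : seq A) : sm_state M * {ffun I -> seq X} :=
  (sm_start M, [ffun i => if i == ord0 then map inl w else [::]]).

Definition sm_step (c : sm_state M * {ffun I -> seq X}) :=
  let: (q, ls) := c in
  if sm_verdict q is Some _ then c else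
  let: (q', ops) := sm_trans q [ffun i => ohead (ls i)] in
  (q', [ffun i => op_apply (ops i) (ls i)]).

Definition first_act (o : stack_op X) (h : option X) : option X * move :=
  match o with
  | Keep => (h, MoveN)
  | Pop => (None, MoveR)
  | Put x => (Some x, MoveN)
  | Push _ => (h, MoveL)
  end.

Definition pending (o : stack_op X) : option X :=
  if o is Push x then Some x else None.

Definition second_act (p : option X) (h : option X) : option X * move :=
  (if p is Some x then Some x else h, MoveN).

(** A push has to move before it writes, whereas a Turing machine writes before
    it moves; the second component of a state holds the letters that are still
    to be written after the move. *)
Definition tm_of : turing_machine A :=
  @TuringMachine A (sm_nstacks M) (sm_aux M)
    (sm_state M * option {ffun I -> option X})%type
    (sm_start M, None)
    (fun q => if q.2 is None then sm_verdict q.1 else None)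
    (fun q hs =>
      if q.2 is Some p then ((q.1, None), [ffun i => second_act (p i) (hs i)])
      else let: (q', ops) := sm_trans q.1 hs in
        ((q', Some [ffun i => pending (ops i)]),
         [ffun i => first_act (ops i) (hs i)])).

(** Cells to the left of the head are left unconstrained: they may be anything,
    since a push overwrites the cell that it enters. *)
Definition tape_stack (t : tape X) (l : seq X) : Prop :=
  exists j, tape_head t :: tape_right t = map Some l ++ nseq j None.

Lemma tape_stack_head t l : tape_stack t l -> tape_head t = ohead l.
Proof. by case=> j; case: l => [|x l]; case: j => [|j] //= [-> _]. Qed.

Definition tape_act (a : option X * move) (t : tape X) : tape X :=
  tape_move a.2 (tape_write a.1 t).

Lemma tape_stack_op t l o : tape_stack t l ->
  let t1 := tape_act (first_act o (tape_head t)) t in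
  tape_stack (tape_act (second_act (pending o) (tape_head t1)) t1)
    (op_apply o l).
Proof.
case: t => u h r [j /= E]; case: o => [||x|x] /=.
- by exists j.
- have [j' rE] : exists j', r = map Some (behead l) ++ nseq j' None.
    case: l j E => [|y l] [|j] //= [_ ->];
      by [exists j | exists 0%N | exists j.+1].
  (* The head may run off the right end of the list, onto one more blank. *)
  case: r rE {E} => [|z r] rE; last by exists j'.
  by exists 1%N; case: (behead l) rE => [|y l'].
- case: l j E => [|y l] [|j] //= [_ ->].
  + by exists j.
  + by exists 0%N.
  + by exists j.+1.
- by exists j; rewrite /= E.
Qed.

Definition simulates (c : tm_config tm_of)
    (d : sm_state M * {ffun I -> seq X}) : Prop :=
  c.1 = (d.1, None) /\ forall i, tape_stack (c.2 i) (d.2 i).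

Lemma simulates_init w : simulates (tm_init tm_of w) (sm_init w).
Proof.
split=> // i; rewrite /= !ffunE; case: eqP => _; last by exists 1%N.
by case: w => [|x w]; [exists 1%N | exists 0%N; rewrite /= cats0].
Qed.

Lemma simulates_step c d : simulates c d ->
  simulates (iter 2 (@tm_step A tm_of) c) (sm_step d).
Proof.
case: c d => [q ts] [q' ls] [/= -> H].
case V: (sm_verdict q') => [b|] /=; first by rewrite /= ?V /= ?V.
rewrite /= ?V /=.
have -> : [ffun i => tape_head (ts i)] = [ffun i => ohead (ls i)].
  by apply/ffunP => i; rewrite !ffunE (tape_stack_head (H i)).
case E: (sm_trans q' _) => [q2 ops] /=; split=> // i; rewrite !ffunE /=.
by rewrite -(tape_stack_head (H i)); apply: tape_stack_op.
Qed.

Lemma tm_of_verdict w t :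
  tm_verdict (iter (2 * t) (@tm_step A tm_of) (tm_init tm_of w)).1 =
  sm_verdict (iter t sm_step (sm_init w)).1.
Proof.
suff [-> _] : simulates (iter (2 * t) (@tm_step A tm_of) (tm_init tm_of w))
                        (iter t sm_step (sm_init w)) by [].
elim: t => [|t IH]; first exact: simulates_init.
by rewrite mulnS iterD iterS; apply: simulates_step.
Qed.

End Simulation.

(** * Words and their sections *)

Definition ev (w : seq letter) : autT := \prod_(x <- w) gen x.

Lemma ev_nil : ev [::] = 1. Proof. exact: big_nil. Qed.
Lemma ev_cons x w : ev (x :: w) = gen x * ev w. Proof. exact: big_cons. Qed.

Lemma word_problem_ev w : word_problem grig_gen w <-> ev w = 1.
Proof.
have E : val (\prod_(x <- w) grig_gen x) = ev w.
  by elim: w => [|x w IH]; rewrite ?big_nil ?ev_nil // big_cons ev_cons -IH.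
by rewrite -E; split=> [-> //|H]; apply: val_inj.
Qed.

Lemma gen_invol x : gen x * gen x = 1.
Proof. by have /(congr1 val) := grig_gen_invol x. Qed.

Lemma genV x : (gen x)^-1 = gen x.
Proof. by apply: (mulgI (gen x)); rewrite mulgV gen_invol. Qed.

Lemma ev_rcons w x : ev (rcons w x) = ev w * gen x.
Proof. by rewrite /ev big_rcons. Qed.

Lemma ev_rev w : ev (rev w) = (ev w)^-1.
Proof.
elim: w => [|x w IH]; first by rewrite ev_nil invg1.
by rewrite rev_cons ev_rcons ev_cons IH invgM genV.
Qed.

Lemma ev_rev1 w : (ev (rev w) == 1) = (ev w == 1).
Proof. by rewrite ev_rev invg_eq1. Qed.

(** [Some None] means that the two letters cancel; [None] that they form a
    reduced word. *)
Definition merge (x y : letter) : option (option letter) :=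
  match x, y with
  | La, La | Lb, Lb | Lc, Lc | Ld, Ld => Some None
  | Lb, Lc | Lc, Lb => Some (Some Ld)
  | Lb, Ld | Ld, Lb => Some (Some Lc)
  | Lc, Ld | Ld, Lc => Some (Some Lb)
  | _, _ => None
  end.

Lemma gen_bc : gen Lb * gen Lc = gen Ld.
Proof.
suff H v : [/\ c_fun (b_fun v) = d_fun v, b_fun (d_fun v) = c_fun v
             & d_fun (c_fun v) = b_fun v].
  by apply: autT_ext => v; have [] := H v.
by elim: v => [|[] v [IHd IHc IHb]] //=; rewrite ?IHd ?IHc ?IHb ?a_funK.
Qed.

(** The whole multiplication table of the Klein four-group follows from
    [bc = d], because the generators are involutions. *)
Lemma merge_ev x y o : merge x y = Some o -> gen x * gen y = ev (seq_of_opt o).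
Proof.
have ev1 z : ev [:: z] = gen z by rewrite ev_cons ev_nil mulg1.
have gen_cb : gen Lc * gen Lb = gen Ld.
  by rewrite -[RHS]genV -gen_bc invgM !genV.
have gen_bd : gen Lb * gen Ld = gen Lc.
  by rewrite -gen_bc mulgA gen_invol mul1g.
have gen_dc : gen Ld * gen Lc = gen Lb.
  by rewrite -gen_bc -mulgA gen_invol mulg1.
have gen_cd : gen Lc * gen Ld = gen Lb.
  by rewrite -gen_cb mulgA gen_invol mul1g.
have gen_db : gen Ld * gen Lb = gen Lc.
  by rewrite -gen_cb -mulgA gen_invol mulg1.
case: x y => [] [] // [<-];
  by rewrite [seq_of_opt _]/= ?ev1 ?ev_nil ?gen_invol ?gen_bc.
Qed.

(** One merge suffices: if [r] alternates between [a] and the other letters, so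
    does the result. *)
Definition cons_reduce (x : letter) (r : seq letter) : seq letter :=
  if r is y :: r' then
    if merge x y is Some o then seq_of_opt o ++ r' else x :: r
  else [:: x].

Definition reduce_onto := foldl (fun r x => cons_reduce x r).

Lemma cons_reduce_ev x r : ev (cons_reduce x r) = gen x * ev r.
Proof.
case: r => [|y r] /=; first by rewrite ev_cons.
case E: (merge x y) => [o|]; last by rewrite !ev_cons.
by rewrite ev_cons mulgA (merge_ev E) /ev big_cat.
Qed.

Lemma reduce_onto_ev r w : ev (reduce_onto r w) = ev (rev w) * ev r.
Proof.
elim: w r => [|x w IH] r /=; first by rewrite ev_nil mul1g.
by rewrite IH cons_reduce_ev rev_cons ev_rcons mulgA.
Qed.

Definition reduce := reduce_onto [::].

(** The letters are stacked one on top of the other, so the reduced word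
    represents the inverse. *)
Lemma reduce_ev w : ev (reduce w) = (ev w)^-1.
Proof. by rewrite /reduce reduce_onto_ev ev_rev ev_nil mulg1. Qed.

Lemma size_reduce w : size (reduce w) <= size w.
Proof.
rewrite /reduce -[leqRHS]add0n -[0%N]/(size (@nil letter)).
elim: w [::] => [|x w IH] r /=; first by rewrite addn0.
apply: leq_trans (IH _) _; rewrite addnS -addSn leq_add2r.
case: r => [|y r] //=; case: (merge x y) => [[z|]|] //=; lia.
Qed.

Definition alternates : rel letter := fun x y => (x == La) != (y == La).

Lemma cons_reduce_sorted x r :
  sorted alternates r -> sorted alternates (cons_reduce x r).
Proof.
case: r => [|y r] //= P.
have step z : (z == La) = (y == La) -> sorted alternates (z :: r).
  by move=> zy; case: r P => [|u r] //=; rewrite /alternates zy.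
case: x y P step => [] [] //= P step;
  by [apply: path_sorted P | apply: step].
Qed.

Lemma reduce_sorted w : sorted alternates (reduce w).
Proof.
rewrite /reduce; elim: w [::] (isT : sorted alternates [::]) => //= x w IH r Hr.
exact/IH/cons_reduce_sorted.
Qed.

(** How a letter acts on the subtree [s] as given by the recursion
    [b = phi a c], [c = phi a d], [d = phi 1 b]; [None] is the identity. *)
Definition component (s : bool) (x : letter) : option letter :=
  match x, s with
  | La, _ => None
  | Lb, false | Lc, false => Some La
  | Lb, true => Some Lc
  | Lc, true => Some Ld
  | Ld, false => None
  | Ld, true => Some Lb
  end.

(** The section at the subtree [s] of the automorphism that [w] represents; an
    [a] emits nothing but moves on to the other subtree. *)
Fixpoint sec (s : bool) (w : seq letter) : seq letter :=
  if w is x :: w' then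
    seq_of_opt (component s x) ++ sec (s (+) (x == La)) w'
  else [::].

Definition par (w : seq letter) : bool := odd (count_mem La w).

Lemma par_cons x w : par (x :: w) = (x == La) (+) par w.
Proof. by rewrite /par /= oddD oddb. Qed.

Lemma ev_section w s v : ev w (s :: v) = (s (+) par w) :: ev (sec s w) v.
Proof.
elim: w s v => [|x w IH] s v.
  by rewrite /= !ev_nil /par /= addbF.
have ev1 z u : ev (z :: sec (s (+) (x == La)) w) u
             = ev (sec (s (+) (x == La)) w) (gen z u).
  by rewrite ev_cons aut_mulE.
rewrite par_cons addbA ev_cons aut_mulE.
have -> : gen x (s :: v) =
    (s (+) (x == La)) :: ev (seq_of_opt (component s x)) v.
  by case: x s {ev1} => [] [] /=; rewrite ?ev_cons ev_nil ?mulg1.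
by rewrite IH /= /ev big_cat.
Qed.

Lemma ev_section1 w :
  (ev w == 1) = [&& ~~ par w, ev (sec false w) == 1 & ev (sec true w) == 1].
Proof.
apply/eqP/and3P => [E | [/negbTE P /eqP E0 /eqP E1]].
  have H s v : s :: v = (s (+) par w) :: ev (sec s w) v.
    by rewrite -ev_section E.
  split; first by have [<-] := H false [::].
  - by apply/eqP/autT_ext => v; have [_ <-] := H false v.
  - by apply/eqP/autT_ext => v; have [_ <-] := H true v.
apply: autT_ext => -[|s v]; first by rewrite aut_root.
by rewrite ev_section P addbF; case: s; rewrite ?E0 ?E1.
Qed.

(** [par] only depends on the represented automorphism, and not on the word: it
    says whether the two subtrees are exchanged. *)
Lemma par_reduce w : par (reduce w) = par w.
Proof.
have E : ev (reduce w) (ev w [:: false]) = [:: false].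
  by rewrite -aut_mulE reduce_ev mulgV.
move: E; rewrite !ev_section aut_root => -[].
by case: (par w); case: (par _).
Qed.

Lemma reduce_ev1 w : (ev (reduce w) == 1) = (ev w == 1).
Proof. by rewrite reduce_ev invg_eq1. Qed.

Lemma size_sec s w : size (sec s w) <= count (predC1 La) w.
Proof.
elim: w s => [|x w IH] s //=; rewrite size_cat leq_add //.
by case: x s => [] [].
Qed.

(** Among alternating words, those that begin and end with a letter other than
    [La] have one such letter more than [La]'s; hence the successor. *)
Lemma alternates_count w : sorted alternates w ->
  (count (predC1 La) w).*2 <= (size w).+1.
Proof.
(* The induction needs to know on which side of the alternation [w] begins. *)
suff H : sorted alternates w ->
    (count (predC1 La) w).*2 <= size w + (head La w != La).
  by move/H=> /leq_trans; apply; rewrite -addn1 leq_add2l leq_b1.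
elim: w => [|x [|y w] IH] //=; first by case: x.
by case/andP => xy /IH /=; case: x y xy {IH} => [] [] //= _; lia.
Qed.

Lemma size_sec_reduce s w : (size (sec s (reduce w))).*2 <= (size w).+1.
Proof.
have := alternates_count (reduce_sorted w).
have := size_sec s (reduce w); have := size_reduce w; lia.
Qed.

(** * The machine *)

(** [Read p] moves a word from the first stack to the second, reducing it, with
    [p] the parity of the [a]'s seen so far.  [Split s] consumes the reduced
    word while following the subtree that starts at 0 and is now [s]; it sends
    the section at 0 to the third stack and the section at 1 to the first.
    [Flush] puts the section at 0 on top of the other one, so that it comes
    first in the search. *)
Inductive phase := Read of bool | Split of bool | Flush | Halt of bool.

Definition phase_code (q : phase) : (bool + bool) + option bool :=
  match q with
  | Read p => inl (inl p) | Split s => inl (inr s)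
  | Flush => inr None | Halt b => inr (Some b)
  end.

Definition phase_decode (c : (bool + bool) + option bool) : phase :=
  match c with
  | inl (inl p) => Read p | inl (inr s) => Split s
  | inr None => Flush | inr (Some b) => Halt b
  end.

Fact phase_codeK : cancel phase_code phase_decode. Proof. by case. Qed.

HB.instance Definition _ := Countable.copy phase (can_type phase_codeK).
HB.instance Definition _ : isFinite phase := CanIsFinite phase_codeK.

Local Notation sym := (letter + unit)%type.
Local Notation sep := (inr tt : sym).

Definition push_opt (o : option letter) : stack_op sym :=
  if o is Some x then Push (inl x) else Keep.

Definition reduce_op (x : letter) (top : option sym) : stack_op sym :=
  if top is Some (inl y) then
    match merge x y with
    | None => Push (inl x)
    | Some None => Pop
    | Some (Some z) => Put (inl z)
    end
  else Push (inl x).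

(** When a nonempty reduced word is to be split, the separator that ended the
    word is left in place, and separates the new words from the older ones.
    Running into the bottom of the first stack ends the last word, and the
    answer is yes once this word, too, has reduced to the empty one. *)
Definition grig_trans (q : phase) (s r u : option sym) :
    phase * (stack_op sym * stack_op sym * stack_op sym) :=
  match q with
  | Read p =>
    match s with
    | Some (inl x) => (Read (p (+) (x == La)), (Pop, reduce_op x r, Keep))
    | _ =>
      if p then (Halt false, (Keep, Keep, Keep))
      else match r, s with
      | Some _, _ => (Split false, (Keep, Keep, Keep))
      | None, Some _ => (Read false, (Pop, Keep, Keep))
      | None, None => (Halt true, (Keep, Keep, Keep))
      end
    end
  | Split t =>
    if r is Some (inl x) then
      (Split (t (+) (x == La)),
       (push_opt (component (~~ t) x), Pop, push_opt (component t x)))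
    else (Flush, (Push sep, Keep, Keep))
  | Flush =>
    if u is Some x then (Flush, (Push x, Keep, Pop))
    else (Read false, (Keep, Keep, Keep))
  | Halt b => (Halt b, (Keep, Keep, Keep))
  end.

Definition triple (T : Type) (x y z : T) : {ffun 'I_3 -> T} :=
  [ffun i : 'I_3 => nth z [:: x; y] i].

Definition grig_machine : stack_machine letter :=
  @StackMachine letter 2 unit phase (Read false)
    (fun q => if q is Halt b then Some b else None)
    (fun q tops =>
      let: (q', (o1, o2, o3)) :=
        grig_trans q (tops ord0) (tops (inord 1)) (tops (inord 2)) in
      (q', triple o1 o2 o3)).

Definition config q (S R U : seq sym) :
    sm_state grig_machine * {ffun 'I_3 -> seq sym} :=
  (q, triple S R U).

Local Notation step := (@sm_step letter grig_machine).

Lemma config_step q S R U :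
  step (config q S R U) =
  let: (q', (o1, o2, o3)) := grig_trans q (ohead S) (ohead R) (ohead U) in
  config q' (op_apply o1 S) (op_apply o2 R) (op_apply o3 U).
Proof.
case V: (@sm_verdict letter grig_machine q) => [b|].
  by case: q V => //= b' [->].
rewrite /config /step V /= !ffunE !inordK //=.
case: (grig_trans _ _ _ _) => q' [[o1 o2] o3]; congr (_, _).
by apply/ffunP => i; rewrite !ffunE; case: i => [[|[|[|i]]] Hi].
Qed.

Lemma read_run p w S r :
  iter (size w) step (config (Read p) (map inl w ++ S) (map inl r) [::]) =
  config (Read (p (+) par w)) S (map inl (reduce_onto r w)) [::].
Proof.
elim: w p r => [|x w IH] p r; first by rewrite /= /par addbF.
rewrite iterSr config_step /= par_cons addbA -IH.
congr (iter _ _ (config _ _ _ _)).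
case: r => [|y r] //=.
by case: (merge x y) => [[z|]|].
Qed.

Lemma op_apply_push_opt o l :
  op_apply (push_opt o) l = map inl (seq_of_opt o) ++ l.
Proof. by case: o. Qed.

(** In phase [Split t] the first stack receives the section at [~~ t], the third
    one the section at [t]. *)
Lemma split_run t r S U :
  iter (size r) step (config (Split t) S (map inl r) U) =
  config (Split (t (+) par r)) (map inl (rev (sec (~~ t) r)) ++ S) [::]
    (map inl (rev (sec t r)) ++ U).
Proof.
elim: r t S U => [|x r IH] t S U; first by rewrite /= /par addbF.
rewrite iterSr config_step /= par_cons addbA IH !op_apply_push_opt addNb.
have rev_opt o : rev (seq_of_opt o) = seq_of_opt o :> seq letter by case: o.
by rewrite !rev_cat !rev_opt !map_cat -!catA.
Qed.

Lemma flush_run S U :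
  iter (size U) step (config Flush S [::] U) =
  config Flush (rev U ++ S) [::] [::].
Proof.
elim: U S => [|x U IH] S //; rewrite iterSr config_step /= IH.
by rewrite rev_cons cat_rcons.
Qed.

Definition encode (ws : seq (seq letter)) : seq sym :=
  if ws is w :: ws' then
    map inl w ++ flatten [seq sep :: map inl u | u <- ws']
  else [::].

(** An empty encoding would still describe one word to be tested, the empty one,
    so the empty list of words has to be a separate, accepting configuration. *)
Definition todo (ws : seq (seq letter)) :=
  if ws is [::] then config (Halt true) [::] [::] [::]
  else config (Read false) (encode ws) [::] [::].

Definition rejects (c : sm_state grig_machine * {ffun 'I_3 -> seq sym}) :=
  @sm_verdict letter grig_machine c.1 = Some false.

(** Within [t] steps the machine either disposes of the trivial word [w] on top
    of an arbitrary list of pending words, or rejects because [w] is not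
    trivial.  Quantifying over [ws] is what lets such statements be chained
    along the recursion. *)
Definition solves (t : nat) (w : seq letter) : Prop :=
  forall ws, exists2 t', t' <= t &
    let c := iter t' step (todo (w :: ws)) in
    if ev w == 1 then c = todo ws else rejects c.

Lemma solvesW t t' w : t <= t' -> solves t w -> solves t' w.
Proof.
move=> tt' H ws; have [u ut ?] := H ws.
by exists u => //; apply: leq_trans tt'.
Qed.

Lemma read_word w ws :
  iter (size w) step (todo (w :: ws)) =
  config (Read (par w)) (flatten [seq sep :: map inl u | u <- ws])
    (map inl (reduce w)) [::].
Proof. exact: (read_run false w _ [::]). Qed.

Lemma solves_odd w : par w -> solves (size w).+1 w.
Proof.
move=> P ws; exists (size w).+1 => //.
rewrite ev_section1 P iterS read_word config_step P /=.
by case: ws.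
Qed.

Lemma solves_cancelled w : reduce w = [::] -> solves (size w).+1 w.
Proof.
move=> E ws; exists (size w).+1 => //=.
have P : par w = false by rewrite -par_reduce E.
rewrite -reduce_ev1 E ev_nil eqxx read_word config_step P E /=.
by case: ws.
Qed.

(** The time is linear in the length of [w], as reduction does not lengthen a
    word and a section is no longer than its word. *)
Lemma split_word w ws : par w = false -> reduce w != [::] ->
  exists2 t, t <= 3 * size w + 3 &
    iter t step (todo (w :: ws)) =
    todo [:: sec false (reduce w), rev (sec true (reduce w)) & ws].
Proof.
move=> P N; set r := reduce w in N *.
set S := flatten [seq sep :: map inl u | u <- ws].
have read : iter (size w).+1 step (todo (w :: ws)) =
    config (Split false) S (map inl r) [::].
  rewrite iterS read_word config_step P -/r -/S.
  by case: (r) N => // x r' _; case: (ws) @S.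
have split : iter (size r).+1 step (config (Split false) S (map inl r) [::]) =
    config Flush (sep :: map inl (rev (sec true r)) ++ S) [::]
      (map inl (rev (sec false r))).
  by rewrite iterS split_run config_step /= cats0.
exists ((size (sec false r)).+1 + ((size r).+1 + (size w).+1)); last first.
  rewrite !iterD read split -(size_rev (sec false r)).
  rewrite -(size_map (inl : letter -> sym)) iterS flush_run config_step /=.
  by rewrite -map_rev revK.
have := size_sec_reduce false w; have := size_reduce w; rewrite -/r.
have := size_sec false r; have := count_size (predC1 La) r; lia.
Qed.

(** The second section is examined only if the first one is trivial.  This keeps
    the time bounded on one-letter words, whose second section is again one
    letter long. *)
Lemma solves_split t0 t1 w : par w = false -> reduce w != [::] ->
  solves t0 (sec false (reduce w)) ->
  (ev (sec false (reduce w)) == 1 -> solves t1 (rev (sec true (reduce w)))) ->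
  solves (3 * size w + 3 + t0 + t1) w.
Proof.
move=> P N H0 H1 ws; have [u Hu runu] := split_word ws P N.
have [u0 Hu0 /=] := H0 (rev (sec true (reduce w)) :: ws).
rewrite -(reduce_ev1 w) (ev_section1 (reduce w)) par_reduce P.
case: ifP H1 => E0 H1 run0 /=; last first.
  by exists (u0 + u); [lia | rewrite iterD runu].
have [u1 Hu1 /=] := H1 isT ws; rewrite ev_rev1 => run1.
by exists (u1 + (u0 + u)); [lia | rewrite !iterD runu run0].
Qed.

(** The section at 0 of [b] and [c] is the odd word [a]. *)
Lemma solves_letter x : x != La -> x != Ld -> solves 8 [:: x].
Proof.
move=> xa xd; have := @solves_split 2 0 [:: x].
have -> : sec false (reduce [:: x]) = [:: La] by case: x xa xd.
apply; first by case: x xa xd.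
- by [].
- exact: (@solves_odd [:: La]).
- by rewrite ev_section1.
Qed.

Lemma solves_base w : size w <= 1 -> solves 15 w.
Proof.
case: w => [|x [|y w]] // _.
  exact: (@solvesW 1 15 [::] isT (@solves_cancelled [::] erefl)).
case: x.
- exact: (@solvesW 2 15 [:: La] isT (@solves_odd [:: La] isT)).
- exact: (@solvesW 8 15 [:: Lb] isT (@solves_letter Lb isT isT)).
- exact: (@solvesW 8 15 [:: Lc] isT (@solves_letter Lc isT isT)).
(* Splitting [d] takes 6 steps, its empty section at 0 takes 1, and its section
   [b] at 1 takes 8. *)
apply: (@solvesW (6 + 1 + 8)) => //.
apply: (@solves_split 1 8 [:: Ld]) => //.
- exact: (@solves_cancelled [::]).
- by move=> _; apply: (@solves_letter Lb).
Qed.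

(** The bound [2 ^ k.+1] is inherited as [2 ^ k] by the sections, because
    [(2 ^ k.+1 + 1) %/ 2 = 2 ^ k].  With [m = (size w).-1 > 0], splitting costs
    at most [3 * m + 6 <= 9 * m] steps, and the two recursive calls have one
    additive constant [15] too many; [24 = 9 + 15] pays for both. *)
Lemma solves_log k w : size w <= 2 ^ k -> solves (24 * (size w).-1 * k + 15) w.
Proof.
elim: k w => [|k IH] w Hw.
  by apply: solvesW (solves_base Hw); rewrite leq_addl.
have [w1|w2] := leqP (size w) 1.
  by apply: solvesW (solves_base w1); rewrite leq_addl.
case P: (par w).
  by apply: solvesW (solves_odd P); nia.
have [/solves_cancelled|N] := eqVneq (reduce w) [::].
  by move=> H; apply: solvesW H; nia.
set r := reduce w in N *.
set m0 := size (sec false r); set m1 := size (sec true r).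
have h0 : m0.*2 <= (size w).+1 := size_sec_reduce false w.
have h1 : m1.*2 <= (size w).+1 := size_sec_reduce true w.
rewrite expnS in Hw.
have H0 : solves (24 * m0.-1 * k + 15) (sec false r) by apply: IH; lia.
have H1 : solves (24 * m1.-1 * k + 15) (rev (sec true r)).
  by rewrite /m1 -size_rev; apply: IH; rewrite size_rev; lia.
apply: solvesW (solves_split P N H0 (fun _ => H1)).
have m01 : m0.-1 + m1.-1 <= (size w).-1 by lia.
have : (m0.-1 + m1.-1) * k <= (size w).-1 * k by rewrite leq_mul2r m01 orbT.
nia.
Qed.

Theorem theorem8p2 :
  exists (M : turing_machine letter) (T : nat -> nat),
    decides_in_time M (word_problem grig_gen) T /\
    big_O T (fun n => (n * trunc_log 2 n)%N).
Proof.
exists (tm_of grig_machine).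
exists (fun n => (2 * (24 * n.-1 * (trunc_log 2 n).+1 + 15))%N).
split=> [w|].
  have size_w : size w <= 2 ^ (trunc_log 2 (size w)).+1.
    exact/ltnW/trunc_log_ltn.
  have [t Ht H] := solves_log size_w [::].
  exists (2 * t)%N, (ev w == 1); split; first by rewrite leq_mul2l.
    rewrite /tm_answers_at tm_of_verdict.
    have -> : sm_init grig_machine w = todo [:: w].
      congr (_, _); apply/ffunP => i; rewrite !ffunE /= cats0.
      by case: i => [[|[|[|i]]] Hi].
    by move: H => /=; case: ifP => _; [move=> -> | exact].
  by split=> [/eqP /word_problem_ev | /word_problem_ev ->].
exists 156, 2 => n n2.
have : 0 < trunc_log 2 n by rewrite trunc_log_gt0.
set k := trunc_log 2 n; nia.
Qed.
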